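(* Every ESP graph $G=(V,E)$ is box-perfect.
   Context: All graphs are finite and simple. ESP graphs. For a multiset $\Lambda$ of cliques of $G$ and $v\in V(G)$, $d_\Lambda(v)$ denotes the number of members of $\Lambda$ (with multiplicity) that contain $v$. A graph $G=(V,E)$ is equitably subpartitionable (ESP) if for every set $\Lambda$ of (inclusionwise) maximal cliques of $G$ there exist two multisets $\Lambda_1,\Lambda_2$ of cliques of $G$ (not necessarily members of $\Lambda$) such that (i) $|\Lambda_1|+|\Lambda_2|\le|\Lambda|$; (ii) $d_{\Lambda_1}(v)+d_{\Lambda_2}(v)\ge d_\Lambda(v)$ for all $v\in V$; (iii) $\min\{d_{\Lambda_1}(v),d_{\Lambda_2}(v)\}\ge\lfloor d_\Lambda(v)/2\rfloor$ for all $v\in V$. Box-perfectness. A rational system $A\boldsymbol x\le \boldsymbol b$ is totally dual integral (TDI) if the minimum in $\max\{\boldsymbol w^T\boldsymbol x: A\boldsymbol x\le \boldsymbol b\}=\min\{\boldsymbol y^T\boldsymbol b:\boldsymbol y^TA=\boldsymbol w^T,\ \boldsymbol y\ge \boldsymbol 0\}$ has an integral optimal solution for every integral vector $\boldsymbol w$ for which the minimum is finite. It is box-TDI if the system $A\boldsymbol x\le \boldsymbol b$, $\boldsymbol l\le \boldsymbol x\le \boldsymbol u$ is TDI for all vectors $\boldsymbol l,\boldsymbol u$ each of whose coordinates is a rational number or $\pm\infty$. For a graph $G$, $A_G$ is the clique-vertex incidence matrix of $G$ (rows indexed by all cliques, columns by vertices). $G$ is box-perfect if the system $A_G\boldsymbol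 x\le \boldsymbol 1$, $\boldsymbol x\ge \boldsymbol 0$ is box-TDI. *)

(* Defs.v *)
From mathcomp Require Import all_boot all_order all_algebra.
From mathcomp Require Import finmap multiset.
From mathcomp Require Import constructive_ereal.

Set Implicit Arguments.
Unset Strict Implicit.
Unset Printing Implicit Defensive.

Import Order.TTheory GRing.Theory Num.Theory.

Local Open Scope ring_scope.

(* A simple graph is a symmetric irreflexive relation [e] on a finType [V].   *)

Definition clique (V : finType) (e : rel V) (K : {set V}) : bool :=
  [forall u in K, forall v in K, (u != v) ==> e u v].

Definition maximal_clique (V : finType) (e : rel V) (K : {set V}) : bool :=
  maxset (clique e) K.

(* [L] lists the members of a multiset of vertex sets, with repetitions.      *)
Definition cover_degree (V : finType) (L : seq {set V}) (v : V) : nat :=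
  count (fun K : {set V} => v \in K) L.

Definition ESP (V : finType) (e : rel V) : Prop :=
  forall L : {set {set V}}, (forall K, K \in L -> maximal_clique e K) ->
  exists L1 L2 : {mset {set V}}%mset,
    [/\ (forall K, K \in L1 -> clique e K) /\ (forall K, K \in L2 -> clique e K),
        (size L1 + size L2 <= #|L|)%N,
        forall v, (cover_degree (enum L) v
                     <= cover_degree L1 v + cover_degree L2 v)%N
      & forall v, ((cover_degree (enum L) v) %/ 2
                     <= minn (cover_degree L1 v) (cover_degree L2 v))%N].

(* The rational system  sum_v (lhs i v) x_v <= rhs i  (i : row).              *)
Record lin_system (V : finType) := LinSystem {
  row : finType;
  lhs : row -> V -> rat;
  rhs : row -> rat
}.

Section TDI.
Variables (R : realFieldType) (V : finType) (S : lin_system V) (w : V -> int).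
Implicit Types y z : row S -> R.

Definition dual_feasible y : Prop :=
  (forall i, 0 <= y i) /\
  (forall v, \sum_i y i * ratr (lhs i v) = (w v)%:~R).

Definition dual_value y : R := \sum_i y i * ratr (rhs i).

Definition dual_finite : Prop :=
  (exists y, dual_feasible y) /\
  (exists c : R, forall y, dual_feasible y -> c <= dual_value y).

Definition dual_optimal y : Prop :=
  dual_feasible y /\ forall z, dual_feasible z -> dual_value y <= dual_value z.

End TDI.

Definition TDI (R : realFieldType) (V : finType) (S : lin_system V) : Prop :=
  forall w : V -> int, dual_finite R S w ->
  exists y : row S -> int, dual_optimal w (fun i => (y i)%:~R : R).

(* [S] together with  l <= x <= u.  There is no row for a bound  -oo <= x_v   *)
(* or  x_v <= +oo;  the unsatisfiable bounds  +oo <= x_v  and  x_v <= -oo     *)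
(* become the unsatisfiable row  0 <= -1.                                     *)
Definition box_system (V : finType) (S : lin_system V) (l u : V -> \bar rat) :
    lin_system V :=
  @LinSystem V
    (row S + ({v : V | l v != -oo%E} + {v : V | u v != +oo%E}))%type
    (fun i x => match i with
     | inl i => lhs i x
     | inr (inl v) => if l (val v) is EFin _ then - (x == val v)%:R else 0
     | inr (inr v) => if u (val v) is EFin _ then (x == val v)%:R else 0
     end)
    (fun i => match i with
     | inl i => rhs i
     | inr (inl v) => if l (val v) is EFin r then - r else - 1
     | inr (inr v) => if u (val v) is EFin r then r else - 1
     end).

Definition box_TDI (R : realFieldType) (V : finType) (S : lin_system V) : Prop :=
  forall l u : V -> \bar rat, TDI R (box_system S l u).

(* A_G x <= 1, x >= 0 *)
Definition clique_system (V : finType) (e : rel V) : lin_system V :=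
  @LinSystem V
    ({K : {set V} | clique e K} + V)%type
    (fun i x => match i with
     | inl K => (x \in val K)%:R
     | inr v => - (x == v)%:R
     end)
    (fun i => match i with inl _ => 1 | inr _ => 0 end).

Definition box_perfect (R : realFieldType) (V : finType) (e : rel V) : Prop :=
  box_TDI R (clique_system e).

(* Main.v *)
From mathcomp Require Import all_boot all_order all_algebra.
From mathcomp Require Import finmap multiset constructive_ereal.
From mathcomp Require Import zify ring lra.
Require Import Defs.

(** Eliminating the multipliers of the bounds turns the dual of the boxed
    clique system into a problem on weighted families of cliques.  Put
    [lower v = max(l_v, 0)] and [upper v = min(u_v, 1)].  A family of cliques
    of total weight [t] that covers each [v] with weight [d_v] has dual value
    at least [t + \sum_v penalty_v (w_v - d_v)], where [penalty_v z] is the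
    larger of [lower v * z] and [upper v * z], and this bound is attained
    ([frac_cost_le_dual], [integral_dual]).  Finiteness of the dual gives
    [lower <= upper] and [\sum_(v in K) lower v <= 1] for every clique [K]
    ([lower_le_upper], [sum_lower]).

    The penalty is convex, nondecreasing, and linear except at 0, so that, as
    [w] is integral, the cost breaks at integral covers only.  Splitting a
    half-integral family into two integral ones as in the definition of ESP
    graphs therefore does not increase the average cost ([cost_halving]):
    every dyadic family is at least as expensive as some integral one.

    Some integral family has least cost, because copies of a clique beyond
    the largest demand can be dropped for free ([cost_minimum]).  No rational
    family is cheaper: after rounding up to a fine dyadic one it would still
    be cheaper than every integral one ([integral_cost_minimum]).  A dual
    solution over the ordered field [R] that were cheaper would yield a
    rational one, as the sign pattern of finitely many rational affine forms
    at a point over [R] also occurs at a rational point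
    ([sign_pattern_transfer], [dual_transfer]). *)

Set Implicit Arguments.
Unset Strict Implicit.
Unset Printing Implicit Defensive.

Import Order.TTheory GRing.Theory Num.Theory.

Local Open Scope ring_scope.

(** * Transfer of rational linear systems to the rationals *)

Lemma sgz_ratr (R : realFieldType) (a : rat) : sgz (ratr a : R) = sgz a.
Proof.
have [a0|a0|->] := ltrgt0P a; last by rewrite rmorph0 !sgz0.
  by rewrite !gtr0_sgz // ltr0q.
by rewrite !ltr0_sgz // ltrq0.
Qed.

Lemma exists_between (J : finType) (A B : pred J) (t : J -> rat) :
    (forall j k, A j -> B k -> t j < t k) ->
  exists q, (forall j, A j -> t j < q) /\ (forall k, B k -> q < t k).
Proof.
move=> ltAB.
(* [b] replaces the missing endpoint when [A] or [B] is empty. *)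
pose b := 1 + \sum_j `|t j|.
have tb j : - b < t j < b.
  rewrite -ltr_norml /b (bigD1 j) //= ltr_pwDl // lerDl.
  by apply: sumr_ge0.
have b_gt0 : 0 < b by rewrite ltr_pwDl // sumr_ge0.
pose lo := \big[Num.max/- b]_(j | A j) t j.
pose hi := \big[Num.min/b]_(k | B k) t k.
have lt_lohi : lo < hi.
  apply: lt_bigmin => [|k Bk]; apply: bigmax_lt => [|j Aj] //.
  - by lra.
  - by case/andP: (tb j).
  - by case/andP: (tb k).
  - exact: ltAB.
exists ((lo + hi) / 2); split=> [j Aj|k Bk].
  have : t j <= lo by exact: le_bigmax_cond.
  lra.
have : hi <= t k by exact: bigmin_le_cond.
lra.
Qed.

(** The position of a point of [R] among finitely many points of [R] is also
    the position of some rational among any rationals lying in the same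
    order: this is where the density of the rationals enters. *)
Lemma same_position (R : realFieldType) (J : finType) (P : pred J)
    (r : J -> R) (t : J -> rat) (x : R) :
    (forall j k, P j -> P k -> sgz (r j - r k) = sgz (t j - t k)) ->
  exists q : rat, forall j, P j -> sgz (x - r j) = sgz (q - t j).
Proof.
move=> same.
have sameE j k : P j -> P k -> (r j < r k) = (t j < t k).
  by move=> Pj Pk; rewrite -subr_lt0 -sgz_lt0 same // sgz_lt0 subr_lt0.
case: (pickP (fun j => P j && (r j == x))) => [j /andP[Pj /eqP <-]|noeq].
  by exists (t j) => k Pk; apply: same.
have [|q [ltq qlt]] := @exists_between J (fun j => P j && (r j < x))
  (fun j => P j && (x < r j)) t.
  by move=> j k /andP[Pj ?] /andP[Pk ?]; rewrite -sameE //; lra.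
exists q => j Pj; have := noeq j; rewrite Pj /=.
case: (ltgtP (r j) x) => // rx _.
  by rewrite !gtr0_sgz ?subr_gt0 // ltq // Pj.
by rewrite !ltr0_sgz ?subr_lt0 // qlt // Pj.
Qed.

(** Every sign pattern that finitely many affine forms with rational
    coefficients realize over an ordered field [R] is realized over the
    rationals.  One variable is eliminated at a time: the signs of the forms
    in that variable are governed by its position among the roots, so that
    it suffices to keep the signs of the differences of the roots. *)
Lemma sign_pattern_transfer (R : realFieldType) (I : eqType) (s : seq I)
    (x : I -> R) (J : finType) (c : J -> rat) (a : J -> I -> rat) :
    uniq s ->
  exists q : I -> rat, forall j,
    sgz (ratr (c j) + \sum_(i <- s) ratr (a j i) * x i)
      = sgz (c j + \sum_(i <- s) a j i * q i).
Proof.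
elim: s J c a => [|i0 s IH] J c a /=.
  move=> _; exists (fun=> 0) => j; rewrite !big_nil !addr0; exact: sgz_ratr.
case/andP=> i0s us.
(* As a form in the variable [i0], the form [j] vanishes at the affine form
   whose coefficients are the [root d j], for [d] the other coefficients of
   [j].  The forms free of [i0] are kept as they are; their roots, defaults
   since the inverse of 0 is 0, are not consulted at the end. *)
pose root (d : rat) j := - (d / a j i0).
pose c' (k : J + J * J) := match k with
  | inl j => c j
  | inr jk => root (c jk.1) jk.1 - root (c jk.2) jk.2 end.
pose a' (k : J + J * J) i := match k with
  | inl j => a j i
  | inr jk => root (a jk.1 i) jk.1 - root (a jk.2 i) jk.2 end.
have [q qE] := IH _ c' a' us.
pose r (j : J) : R :=
  ratr (root (c j) j) + \sum_(i <- s) ratr (root (a j i) j) * x i.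
pose t (j : J) := root (c j) j + \sum_(i <- s) root (a j i) j * q i.
have rt j k : sgz (r j - r k) = sgz (t j - t k).
  have := qE (inr (j, k)); rewrite /= -/(r j) -/(r k).
  under eq_bigr do rewrite rmorphB mulrBl.
  rewrite sumrB; under [in RHS]eq_bigr do rewrite mulrBl.
  rewrite sumrB rmorphB => H.
  have -> : r j - r k = ratr (root (c j) j) - ratr (root (c k) k) +
     (\sum_(i <- s) ratr (root (a j i) j) * x i -
      \sum_(i <- s) ratr (root (a k i) k) * x i) by rewrite /r; ring.
  by rewrite H; congr sgz; rewrite /t; ring.
have [q0 q0E] := @same_position R J predT r t (x i0) (fun j k _ _ => rt j k).
pose q' i := if i == i0 then q0 else q i.
exists q' => j; rewrite !big_cons.
have q'E : \sum_(i <- s) a j i * q' i = \sum_(i <- s) a j i * q i.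
  apply: eq_big_seq => i is_; rewrite /q'; case: eqP => // ii0.
  by rewrite -ii0 is_ in i0s.
rewrite q'E {1}/q' eqxx.
have [a0|a0] := eqVneq (a j i0) 0.
  by rewrite a0 rmorph0 !mul0r !add0r; have := qE (inl j).
have ra0 : ratr (a j i0) != 0 :> R by rewrite fmorph_eq0.
transitivity (sgz (ratr (a j i0) * (x i0 - r j))).
  congr sgz; rewrite /r mulrBr mulrDr mulr_sumr.
  under [in RHS]eq_bigr do
    rewrite mulrA -rmorphM /root mulrN mulrCA divff // mulr1 rmorphN mulNr.
  by rewrite sumrN -rmorphM /root mulrN mulrCA divff // mulr1 rmorphN; ring.
transitivity (sgz (a j i0 * (q0 - t j))).
  by rewrite sgzM sgz_ratr q0E // -sgzM.
congr sgz; rewrite /t mulrBr mulrDr mulr_sumr.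
under eq_bigr do rewrite mulrA /root mulrN mulrCA divff // mulr1 mulNr.
by rewrite sumrN /root mulrN mulrCA divff // mulr1; ring.
Qed.

(** Over a non-archimedean field the values of two dual solutions can differ
    by an infinitesimal, which no approximation by rationals detects; the
    transfer of signs does. *)
Lemma dual_transfer (R : realFieldType) (V : finType) (S : lin_system V)
    (w : V -> int) (b : rat) (y : row S -> R) :
    dual_feasible w y -> dual_value y < ratr b ->
  exists z : row S -> rat,
    [/\ forall i, 0 <= z i,
        forall v, \sum_i z i * lhs i v = (w v)%:~R
      & \sum_i z i * rhs i < b].
Proof.
move=> [y_ge0 y_eq] y_lt.
pose c (k : row S + option V) : rat := match k with
  | inl i => 0 | inr (Some v) => - (w v)%:~R | inr None => - b end.
pose a (k : row S + option V) i : rat := match k with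
  | inl j => (j == i)%:R | inr (Some v) => lhs i v | inr None => rhs i end.
have [z zE] := sign_pattern_transfer y c a (enum_uniq (row S)).
have unit_form (F : realFieldType) (f : row S -> F) i :
    \sum_(j <- enum (row S)) (i == j)%:R * f j = f i.
  rewrite big_enum (bigD1 i) //= eqxx mul1r big1 ?addr0 // => j ji.
  by rewrite eq_sym (negbTE ji) mul0r.
exists z; split=> [i|v|].
- have := zE (inl i); rewrite /= rmorph0 !add0r unit_form.
  under eq_bigr do rewrite ratr_nat.
  by rewrite unit_form => H; rewrite -sgz_ge0 -H sgz_ge0.
- have := zE (inr (Some v)); rewrite /= !big_enum /=.
  under eq_bigr do rewrite mulrC.
  under [in RHS]eq_bigr do rewrite mulrC.
  rewrite y_eq rmorphN /= ratr_int addNr sgz0 => /esym/eqP.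
  by rewrite sgz_eq0 addrC subr_eq0 => /eqP.
- have := zE (inr None); rewrite /= !big_enum /=.
  under eq_bigr do rewrite mulrC.
  under [in RHS]eq_bigr do rewrite mulrC.
  move=> H; move: y_lt; rewrite -subr_lt0 -sgz_lt0 /dual_value addrC -rmorphN.
  by rewrite H sgz_lt0 addrC subr_lt0.
Qed.

(** * Halving multisets of cliques in an ESP graph *)

Section Halving.

Variables (V : finType) (e : rel V).

Lemma cover_degree_cat (L1 L2 : seq {set V}) v :
  cover_degree (L1 ++ L2) v = (cover_degree L1 v + cover_degree L2 v)%N.
Proof. exact: count_cat. Qed.

Lemma extend_to_maximal (L : seq {set V}) :
    (forall K, K \in L -> clique e K) ->
  exists M, [/\ forall K, K \in M -> maximal_clique e K, size M = size L
    & forall v, (cover_degree L v <= cover_degree M v)%N].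
Proof.
elim: L => [|K L IH] cliqL; first by exists [::].
have [|M [maxM szM leM]] := IH.
  by move=> K' K'L; apply: cliqL; rewrite inE K'L orbT.
have [|K' maxK' sKK'] := @maxset_exists _ (clique e) K.
  by apply: cliqL; rewrite mem_head.
exists (K' :: M); split=> [K''||v]; rewrite /= ?szM //.
  by rewrite inE => /predU1P[->|/maxM].
apply: leq_add (leM v); case vK: (v \in K) => //.
by rewrite (subsetP sKK').
Qed.

Lemma perm_enum_setU1 (T : finType) (x : T) (A : {set T}) :
  x \notin A -> perm_eq (enum (x |: A)) (x :: enum A).
Proof.
move=> xA; apply: uniq_perm => /=; rewrite ?enum_uniq ?mem_enum ?xA // => y.
by rewrite mem_enum !inE mem_enum.
Qed.

Lemma perm_pairs (T : finType) (L : seq T) :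
  exists (M : seq T) (A : {set T}), perm_eq L (M ++ M ++ enum A).
Proof.
elim: L => [|K L [M [A /permP IH]]].
  by exists [::], set0; rewrite enum_set0.
have [KA|KA] := boolP (K \in A).
  exists (K :: M), (A :\ K); apply/permP => a; rewrite /= {}IH.
  have /permP/(_ a) := perm_enum_setU1 (negbT (setD11 K A)).
  by rewrite setD1K //= !count_cat /= !count_cat => ->; lia.
exists M, (K |: A); apply/permP => a; rewrite /= {}IH.
by have /permP/(_ a) := perm_enum_setU1 KA; rewrite !count_cat /= => ->; lia.
Qed.

(** The ESP property speaks of sets of maximal cliques only.  It passes to
    multisets of cliques: a clique occurring twice can be given to both
    halves, so that only a set is left to be split, and enlarging a clique
    never decreases a degree. *)
Lemma ESP_halving (L : seq {set V}) :
    ESP e -> (forall K, K \in L -> clique e K) ->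
  exists L1 L2 : seq {set V},
    [/\ (forall K, K \in L1 -> clique e K) /\ (forall K, K \in L2 -> clique e K),
        (size L1 + size L2 <= size L)%N,
        forall v, (cover_degree L v <= cover_degree L1 v + cover_degree L2 v)%N
      & forall v, (cover_degree L v)./2
          <= minn (cover_degree L1 v) (cover_degree L2 v)]%N.
Proof.
move=> espG cliqL.
have [N [maxN szN leN]] := extend_to_maximal cliqL.
have [M [A permN]] : exists (M : seq {set V}) (A : {set {set V}}),
  perm_eq N (M ++ M ++ enum A) := perm_pairs N.
have inN K : K \in M ++ M ++ enum A -> maximal_clique e K.
  by rewrite -(perm_mem permN); apply: maxN.
have [B1 [B2 [[cB1 cB2] szB leB halfB]]] : exists B1 B2 : seq {set V},
    [/\ (forall K, K \in B1 -> clique e K) /\ (forall K, K \in B2 -> clique e K),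
        (size B1 + size B2 <= #|A|)%N,
        forall v, (cover_degree (enum A) v
          <= cover_degree B1 v + cover_degree B2 v)%N
      & forall v, (cover_degree (enum A) v %/ 2
          <= minn (cover_degree B1 v) (cover_degree B2 v))%N].
  have [|B1 [B2 splitA]] := espG A; last by exists B1, B2.
  by move=> K KA; apply: inN; rewrite !mem_cat mem_enum KA !orbT.
have cM K : K \in M -> clique e K.
  by move=> KM; apply: (maxsetp (inN K _)); rewrite mem_cat KM.
have sizeN : size N = (size M + (size M + #|A|))%N.
  by rewrite (perm_size permN) !size_cat -cardE.
have coverN v : cover_degree N v
    = (cover_degree M v + (cover_degree M v + cover_degree (enum A) v))%N.
  by rewrite -!cover_degree_cat; apply: (permP permN).
exists (M ++ B1), (M ++ B2); split.
- by split=> K; rewrite mem_cat => /orP[/cM|] //; [apply: cB1|apply: cB2].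
- by rewrite !size_cat; lia.
- move=> v; apply: (leq_trans (leN v)); rewrite coverN !cover_degree_cat.
  by have := leB v; lia.
- move=> v; apply: (leq_trans (half_leq (leN v))).
  by rewrite coverN !cover_degree_cat; have := halfB v; lia.
Qed.

End Halving.

(** * The cost of a multiset of cliques *)

Section Cost.

Variables (V : finType) (e : rel V) (lo hi : V -> rat) (w : V -> int).
Hypothesis lo_ge0 : forall v, 0 <= lo v.
Hypothesis le_lohi : forall v, lo v <= hi v.
Hypothesis sum_lo : forall K, clique e K -> \sum_(v in K) lo v <= 1.

(** The cost of balancing a demand that exceeds the cover by [z]: a missing
    unit costs [hi v], and a superfluous one, for [z] negative, refunds
    [lo v]. *)
Definition penalty (v : V) (z : rat) : rat := Num.max (lo v * z) (hi v * z).

Lemma penalty_ge0E v z : 0 <= z -> penalty v z = hi v * z.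
Proof. by move=> z0; apply: max_r; rewrite ler_wpM2r. Qed.

Lemma penalty_le0E v z : z <= 0 -> penalty v z = lo v * z.
Proof. by move=> z0; apply: max_l; rewrite ler_wnM2r. Qed.

Lemma penalty_mono v : {homo penalty v : x y / x <= y}.
Proof.
move=> x y lexy; rewrite /penalty ge_max !le_max.
by rewrite !ler_wpM2l ?orbT // (le_trans (lo_ge0 v)).
Qed.

Lemma penaltyM v m z : 0 <= m -> penalty v (m * z) = m * penalty v z.
Proof. by move=> m0; rewrite /penalty maxr_pMr // !(mulrCA m). Qed.

(** The penalty is nondecreasing, and its only break, at 0, is an integer.  It
    is therefore linear between the two integers nearest to the half of an odd
    [z], and replacing two copies of that half by those integers costs
    nothing. *)
Lemma penalty_halving v (a b z : int) :
    (a + b <= z)%R -> (a + a <= z + 1)%R -> (b + b <= z + 1)%R ->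
  penalty v a%:~R + penalty v b%:~R <= penalty v z%:~R.
Proof.
move=> abz az bz; have h0 := le_trans (lo_ge0 v) (le_lohi v).
have abzQ : a%:~R + b%:~R <= z%:~R :> rat by rewrite -intrD ler_int.
have signP (x : int) : ((0 <= x%:~R :> rat) && (0 <= x)%R)
    || ((x%:~R <= 0 :> rat) && (x <= 0)%R).
  by rewrite ler0z lerz0 !andbb; lia.
have [/andP[z0 z0']|/andP[z0 z0']] := orP (signP z); last first.
  have a0 : a%:~R <= 0 :> rat by rewrite lerz0; lia.
  have b0 : b%:~R <= 0 :> rat by rewrite lerz0; lia.
  by rewrite !penalty_le0E // -mulrDr ler_wpM2l.
rewrite (penalty_ge0E v z0).
have [/andP[a0 a0']|/andP[a0 a0']] := orP (signP a).
  rewrite (penalty_ge0E v a0).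
  have [/andP[b0 b0']|/andP[b0 b0']] := orP (signP b).
    by rewrite (penalty_ge0E v b0) -mulrDr ler_wpM2l.
  have leaz : a%:~R <= z%:~R :> rat by rewrite ler_int; lia.
  rewrite (penalty_le0E v b0) -[leRHS]addr0 lerD ?ler_wpM2l //.
  by rewrite mulr_ge0_le0.
rewrite (penalty_le0E v a0) addrC.
have [/andP[b0 b0']|/andP[b0 b0']] := orP (signP b).
  have lebz : b%:~R <= z%:~R :> rat by rewrite ler_int; lia.
  rewrite (penalty_ge0E v b0) -[leRHS]addr0 lerD ?ler_wpM2l //.
  by rewrite mulr_ge0_le0.
rewrite (penalty_le0E v b0).
have := mulr_ge0 h0 z0; have := mulr_ge0_le0 (lo_ge0 v) a0.
by have := mulr_ge0_le0 (lo_ge0 v) b0; lra.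
Qed.

(** [L] stands for the fractional family giving every clique its multiplicity
    in [L] divided by [m], and the cost is that of this family times [m]. *)
Definition cost (m : nat) (L : seq {set V}) : rat :=
  (size L)%:R + \sum_v penalty v (w v * m%:Z - (cover_degree L v)%:Z)%:~R.

(** Of the two halves of [L], the cheaper one is taken. *)
Lemma cost_halving m L :
    ESP e -> (forall K, K \in L -> clique e K) ->
  exists2 M : seq {set V}, forall K, K \in M -> clique e K
    & cost m M * 2 <= cost (m * 2) L.
Proof.
move=> espG cliqL.
have [L1 [L2 [[c1 c2] szL leL halfL]]] := ESP_halving espG cliqL.
have le2 : cost m L1 + cost m L2 <= cost (m * 2) L.
  rewrite /cost addrACA -natrD lerD ?ler_nat // -big_split /=.
  apply: ler_sum => v _; apply: penalty_halving.
  - by have := leL v; lia.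
  - by have := halfL v; lia.
  - by have := halfL v; lia.
by have [le12|/ltW le21] := lerP (cost m L1) (cost m L2);
  [exists L1 | exists L2] => //; lra.
Qed.

Lemma cost_dyadic k L :
    ESP e -> (forall K, K \in L -> clique e K) ->
  exists2 M : seq {set V}, forall K, K \in M -> clique e K
    & cost 1 M * (2 ^ k)%:R <= cost (2 ^ k) L.
Proof.
move=> espG; elim: k L => [|k IH] L cliqL; first by exists L; rewrite ?mulr1.
have := @cost_halving (2 ^ k) _ espG cliqL; rewrite -expnSr => -[M cliqM leM].
have [N cliqN leN] := IH M cliqM; exists N => //.
apply: (le_trans _ leM); rewrite expnSr natrM mulrA.
by rewrite ler_wpM2r.
Qed.

(** A clique repeated beyond every demand overcovers all its vertices, so that
    dropping one copy saves 1 and loses the refunds [lo v] of its vertices,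
    at most 1 in total. *)
Lemma cost_rem L K :
    clique e K -> (forall v, w v < (count_mem K L)%:Z)%R ->
  cost 1 (rem K L) <= cost 1 L.
Proof.
move=> cliqK wlt.
have [KL|KL] := boolP (K \in L); last by rewrite rem_id.
have pL := perm_to_rem KL.
have szL : size L = (size (rem K L)).+1 by rewrite (perm_size pL).
have coverL v : cover_degree L v = ((v \in K) + cover_degree (rem K L) v)%N.
  by rewrite /cover_degree (permP pL).
have countL v : v \in K -> (count_mem K L <= cover_degree L v)%N.
  by move=> vK; apply: sub_count => K' /eqP->.
rewrite /cost szL -[in leRHS]natr1 -addrA lerD2l.
suff : \sum_v penalty v (w v * 1%:Z - (cover_degree (rem K L) v)%:Z)%:~R
    <= \sum_v ((if v \in K then lo v else 0)
        + penalty v (w v * 1%:Z - (cover_degree L v)%:Z)%:~R).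
  by rewrite big_split /= -big_mkcond /=; have := sum_lo cliqK; lra.
apply: ler_sum => v _; rewrite coverL; case: ifP => vK; last by rewrite add0n add0r.
have := countL v vK; have := wlt v; rewrite coverL vK => wltv countv.
rewrite !penalty_le0E ?lerz0; try lia.
rewrite -lerBlDr -mulrBr -[leRHS]mulr1 ler_wpM2l // -intrB (ler_int _ _ 1); lia.
Qed.

(** A long sequence repeats some clique beyond every demand, hence can be
    shortened for free. *)
Lemma cost_bounded_size :
  exists B, forall L, (forall K, K \in L -> clique e K) ->
  exists M, [/\ forall K, K \in M -> clique e K, (size M <= B)%N
    & cost 1 M <= cost 1 L].
Proof.
pose W := (\sum_v `|w v|)%N.
have wW v : (w v <= W%:Z)%R by rewrite /W (bigD1 v) //=; lia.
exists (#|{set V}| * W)%N => L; have [n] := ubnP (size L).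
elim: n L => // n IH L szL cliqL.
have [|large] := leqP (size L) (#|{set V}| * W); first by exists L.
have [K ltK] : exists K, (W < count_mem K L)%N.
  apply/existsP; apply: contraLR large; rewrite negb_exists -leqNgt.
  move=> /forallP small; rewrite -sum_nat_const.
  apply: (@leq_trans (\sum_(K : {set V}) count_mem K L)).
    rewrite -sum1_size; under [leqRHS]eq_bigr do rewrite -sum1_count big_mkcond.
    rewrite exchange_big; apply: leq_sum => K _.
    by rewrite (bigD1 K) //= eqxx.
  by apply: leq_sum => K _; rewrite leqNgt.
have KL : K \in L by rewrite -has_pred1 has_count (leq_ltn_trans _ ltK).
have [||M [cliqM szM leM]] := IH (rem K L).
- by rewrite size_rem //; lia.
- by move=> K' /mem_rem/cliqL.
exists M; split=> //; apply: (le_trans leM); apply: cost_rem => [|v].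
  exact: cliqL.
by have := wW v; lia.
Qed.

Lemma cost_minimum :
  exists2 L : seq {set V}, forall K, K \in L -> clique e K
    & forall M, (forall K, K \in M -> clique e K) -> cost 1 L <= cost 1 M.
Proof.
have [B leB] := cost_bounded_size.
pose P (L : B.-bseq {set V}) := all (clique e) L.
have P0 : P [bseq] by [].
case: (arg_minP (fun L : B.-bseq {set V} => cost 1 L) P0) => L PL minL.
exists (L : seq {set V}) => [K|M cliqM]; first exact: (allP PL).
have [N [cliqN szN leN]] := leB M cliqM; apply: le_trans leN.
by apply: (minL (Bseq szN)); apply/allP.
Qed.

Definition frac_cost (y : {K : {set V} | clique e K} -> rat) : rat :=
  \sum_K y K +
  \sum_v penalty v ((w v)%:~R - \sum_K y K * (v \in val K)%:R).

(** Rounding the weights up only increases the covers, so that it costs at most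
    one unit per clique. *)
Lemma round_up (y : {K : {set V} | clique e K} -> rat) (m : nat) :
    (0 < m)%N -> (forall K, 0 <= y K) ->
  exists2 L : seq {set V}, forall K, K \in L -> clique e K
    & cost m L <= frac_cost y * m%:R + #|{: {K : {set V} | clique e K}}|%:R.
Proof.
move=> m_gt0 y_ge0; pose c K := `|Num.ceil (y K * m%:R)|%N.
have cE K : y K * m%:R <= (c K)%:R <= y K * m%:R + 1.
  have cge0 : (0 <= Num.ceil (y K * m%:R))%R.
    by rewrite ceil_ge0 (@lt_le_trans _ _ 0) // mulr_ge0.
  have -> : (c K)%:R = (Num.ceil (y K * m%:R))%:~R :> rat.
    by rewrite pmulrn /c gez0_abs.
  by have := ceilB1_lt (y K * m%:R); rewrite ceil_ge intrB /=; lra.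
pose L := flatten [seq nseq (c K) (val K) | K <- enum {: {K : {set V} | clique e K}}].
exists L => [K /flattenP[s /mapP[K' _ ->]]|].
  by rewrite mem_nseq => /andP[_ /eqP->]; apply: valP.
have countL (a : pred {set V}) : (count a L)%:R = \sum_K (c K)%:R * (a (val K))%:R :> rat.
  rewrite count_flatten -map_comp sumnE big_map natr_sum big_enum /=.
  by apply: eq_bigr => K _; rewrite /= count_nseq mulnC natrM.
rewrite /cost /frac_cost -count_predT countL mulrDl -addrAC lerD //.
  rewrite mulr_suml -sum1_card natr_sum -big_split /= ler_sum // => K _.
  by rewrite mulr1; case/andP: (cE K).
rewrite mulr_suml ler_sum // => v _; rewrite -[leRHS]mulrC -penaltyM //.
apply: penalty_mono; rewrite intrB intrM mulrBr mulrC lerD2l lerN2.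
rewrite -[_%:~R]/(_%:R) countL mulr_sumr ler_sum // => K _.
by rewrite mulrA ler_wpM2r // mulrC; case/andP: (cE K).
Qed.

(** A fractional family cheaper than all integral ones would still be so after
    rounding up its weights to multiples of [2 ^- k], for [k] large; but
    halving [k] times turns the rounded family into an integral one that is
    at least as cheap. *)
Lemma integral_cost_minimum :
  ESP e ->
  exists2 L : seq {set V}, forall K, K \in L -> clique e K
    & forall y, (forall K, 0 <= y K) -> cost 1 L <= frac_cost y.
Proof.
move=> espG; have [L cliqL minL] := cost_minimum.
exists L => // y y_ge0; rewrite leNgt; apply/negP => lt_y.
pose N := #|{: {K : {set V} | clique e K}}|; pose d := cost 1 L - frac_cost y.
have d_gt0 : 0 < d by rewrite subr_gt0.
have [k ltk] : exists k, N%:R < d * (2 ^ k)%:R.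
  exists (Num.bound (N%:R / d)); rewrite mulrC -ltr_pdivrMr //.
  have := @archi_boundP rat (N%:R / d); rewrite divr_ge0 ?ler0n ?(ltW d_gt0) //.
  by move=> /(_ isT) /lt_trans; apply; rewrite ltr_nat ltn_expl.
have [|M cliqM leM] := @round_up y (2 ^ k) _ y_ge0; first by rewrite expn_gt0.
have [M1 cliqM1 leM1] := cost_dyadic k espG cliqM.
have : cost 1 L * (2 ^ k)%:R <= cost 1 M1 * (2 ^ k)%:R.
  by apply: ler_wpM2r; [exact: ler0n | exact: minL].
have := le_trans leM1 leM; move: ltk; rewrite -/N /d.
by move: (2 ^ k)%:R (N%:R) => Q N'; lra.
Qed.

End Cost.

(** * Dual solutions of a box-constrained clique system *)

Lemma big_count_mem (M : nmodType) (I : finType) (a : I -> M) (s : seq I) :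
  \sum_(i <- s) a i = \sum_i a i *+ count_mem i s.
Proof.
elim: s => [|j s IH]; first by rewrite big_nil big1 // => i _; rewrite mulr0n.
transitivity (\sum_i (a i *+ (j == i) + a i *+ count_mem i s)).
  rewrite big_cons {}IH big_split; congr (_ + _).
  rewrite (bigD1 j) //= eqxx big1 ?addr0 // => i ij.
  by rewrite eq_sym (negbTE ij).
by apply: eq_bigr => i _; rewrite -mulrnDr.
Qed.

(** Rows whose left-hand sides cancel span a ray of the dual polyhedron, along
    which the dual value would be unbounded if it decreased. *)
Lemma dual_finite_ray (R : realFieldType) (V : finType) (S : lin_system V)
    (w : V -> int) (s : seq (row S)) :
    dual_finite R S w -> (forall v, \sum_(i <- s) lhs i v = 0) ->
  0 <= \sum_(i <- s) rhs i.
Proof.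
move=> [[y [y_ge0 y_eq]] [c le_c]] s0; rewrite leNgt; apply/negP => slt0.
have sumE (a : row S -> rat) (t : R) :
    \sum_i (y i + t * (count_mem i s)%:R) * ratr (a i)
    = \sum_i y i * ratr (a i) + t * ratr (\sum_(i <- s) a i).
  under eq_bigr do rewrite mulrDl -mulrA.
  rewrite big_split -mulr_sumr; congr (_ + _ * _).
  rewrite [in RHS]big_count_mem rmorph_sum /=; apply: eq_bigr => i _.
  by rewrite rmorphMn /= mulr_natl.
pose b : R := ratr (\sum_(i <- s) rhs i).
have b_lt0 : b < 0 by rewrite ltrq0.
(* The step along the ray at which the value is [c - 1]. *)
pose t := (dual_value y - c + 1) / - b.
have le_y := le_c y (conj y_ge0 y_eq).
have t_ge0 : 0 <= t by apply: divr_ge0; lra.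
have /le_c : dual_feasible w (fun i => y i + t * (count_mem i s)%:R).
  split=> [i|v]; first by rewrite addr_ge0 ?(mulr_ge0 t_ge0) ?ler0n.
  by rewrite sumE s0 rmorph0 mulr0 addr0 y_eq.
rewrite /dual_value sumE -/(dual_value y) -/b /t invrN mulrN mulNr.
by rewrite divfK ?lt_eqF //; lra.
Qed.

Section BoxSystem.

Variables (R : realFieldType) (V : finType) (e : rel V).
Variables (l u : V -> \bar rat) (w : V -> int).

Let S := box_system (clique_system e) l u.
Hypothesis fin : dual_finite R S w.

(** The bounds that the box, the nonnegativity constraints and the clique
    inequalities of single vertices together impose on the coordinate [v].
    The values at [l v = +oo] and [u v = -oo] are defaults: a finite dual
    excludes these cases. *)
Definition lower v : rat := if l v is EFin a then Num.max a 0 else 0.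
Definition upper v : rat := if u v is EFin a then Num.min a 1 else 1.

Lemma clique1 v : clique e [set v].
Proof.
by apply/forall_inP => x /set1P->; apply/forall_inP => y /set1P->; rewrite eqxx.
Qed.

Lemma lower_ge0 v : 0 <= lower v.
Proof. by rewrite /lower; case: (l v) => [a||] //; rewrite le_max lexx orbT. Qed.

(** The unsatisfiable row [0 <= -1] is by itself a decreasing ray. *)
Lemma l_neq_pinfty v : l v != +oo%E.
Proof.
apply/eqP => lv; have lv' : l v != -oo%E by rewrite lv.
have := @dual_finite_ray R V S w [:: inr (inl (exist _ v lv'))] fin.
by rewrite big_seq1 /= lv oppr_ge0 ler10 => H; apply/notF/H => x; rewrite big_seq1 /= lv.
Qed.

Lemma u_neq_ninfty v : u v != -oo%E.
Proof.
apply/eqP => uv; have uv' : u v != +oo%E by rewrite uv.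
have := @dual_finite_ray R V S w [:: inr (inr (exist _ v uv'))] fin.
by rewrite big_seq1 /= uv oppr_ge0 ler10 => H; apply/notF/H => x; rewrite big_seq1 /= uv.
Qed.

(** The bound [lower v <= x_v] is either the bound of the box or [0 <= x_v]. *)
Lemma exists_down_row :
  exists down : V -> row S,
    forall v, (forall x, lhs (down v) x = - (x == v)%:R)
      /\ rhs (down v) = - lower v.
Proof.
apply: (@fin_all_exists V (fun=> row S) (fun v i =>
  (forall x, lhs i x = - (x == v)%:R) /\ rhs i = - lower v)) => v.
have [lv0|lv0] := eqVneq (lower v) 0.
  by exists (inl (inr v)); rewrite lv0 oppr0.
have lv' : l v != -oo%E by apply: contraNneq lv0; rewrite /lower => ->.
exists (inr (inl (exist _ v lv'))); move: lv0; rewrite /= /lower.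
have := l_neq_pinfty v; case: (l v) lv' => [a||] // _ _.
by case: (lerP a 0) => // _; rewrite eqxx.
Qed.

(** The bound [x_v <= upper v] is either the bound of the box or the clique
    inequality of [v] alone. *)
Lemma exists_up_row :
  exists up : V -> row S,
    forall v, (forall x, lhs (up v) x = (x == v)%:R) /\ rhs (up v) = upper v.
Proof.
apply: (@fin_all_exists V (fun=> row S) (fun v i =>
  (forall x, lhs i x = (x == v)%:R) /\ rhs i = upper v)) => v; rewrite /upper.
have viaClique : exists i : row S,
    (forall x, lhs i x = (x == v)%:R) /\ rhs i = 1.
  by exists (inl (inl (exist _ [set v] (clique1 v)))); split=> // x /=; rewrite inE.
have [uv|uv] := eqVneq (u v) +oo%E; first by rewrite uv; exact: viaClique.
have := u_neq_ninfty v; case uv': (u v) => [a||] // _.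
case: (lerP a 1) => // _.
by exists (inr (inr (exist _ v uv))); rewrite /= uv'.
Qed.

Definition clique_row (K : {K : {set V} | clique e K}) : row S := inl (inl K).

Lemma lower_le_upper v : lower v <= upper v.
Proof.
have [down downP] := exists_down_row; have [up upP] := exists_up_row.
have := @dual_finite_ray R V S w [:: up v; down v] fin.
rewrite !big_cons !big_nil (downP v).2 (upP v).2 addr0 subr_ge0; apply=> x.
by rewrite !big_cons !big_nil (downP v).1 (upP v).1 addr0 subrr.
Qed.

(** The row of [K] and the lower bounds on its vertices cancel, hence span a
    ray. *)
Lemma sum_lower K : clique e K -> \sum_(v in K) lower v <= 1.
Proof.
move=> cliqK; have [down downP] := exists_down_row.
pose s := clique_row (exist _ K cliqK) :: [seq down v | v <- enum K].
have sE a : \sum_(i <- s) a i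
    = a (clique_row (exist _ K cliqK)) + \sum_(v in K) a (down v) :> rat.
  by rewrite big_cons big_map big_enum.
have := @dual_finite_ray R V S w s fin; rewrite sE.
under eq_bigr do rewrite (downP _).2.
rewrite sumrN subr_ge0; apply=> x; rewrite sE.
under eq_bigr do rewrite (downP _).1.
rewrite sumrN; apply/eqP; rewrite subr_eq0; apply/eqP.
rewrite big_mkcond (bigD1 x) //= eqxx big1 ?addr0; first by case: (x \in K).
by move=> v vx; rewrite eq_sym (negbTE vx); case: ifP.
Qed.

(** Weak duality, against the points of the box whose coordinates are [lower]
    or [upper] according to the sign of the uncovered demand: at these points
    the penalty is linear, and every row other than those of the cliques is
    satisfied, so that its multiplier can only increase the dual value. *)
Lemma frac_cost_le_dual (y : row S -> rat) :
    (forall i, 0 <= y i) ->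
    (forall v, \sum_i y i * lhs i v = (w v)%:~R) ->
  frac_cost lower upper w (y \o clique_row) <= \sum_i y i * rhs i.
Proof.
move=> y_ge0 y_eq.
pose d v : rat := (w v)%:~R - \sum_K y (clique_row K) * (v \in val K)%:R.
pose x v := if 0 <= d v then upper v else lower v.
have penE v : penalty lower upper v (d v) = x v * d v.
  rewrite /x; case: (lerP 0 (d v)) => [d0|/ltW d0].
    by rewrite (penalty_ge0E lower_le_upper).
  by rewrite (penalty_le0E lower_le_upper).
have lex v : lower v <= x v <= upper v.
  by rewrite /x; case: ifP; rewrite lexx ?lower_le_upper.
have single v (c : rat) : \sum_z c * (z == v)%:R * x z = c * x v.
  rewrite (bigD1 v) //= eqxx mulr1 big1 ?addr0 // => z zv.
  by rewrite (negbTE zv) mulr0 mul0r.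
have rowP i : 0 <= rhs (i : row S) - \sum_v lhs i v * x v
    \/ exists K, i = clique_row K.
  case: i => [[K|v]|[[v lv]|[v uv]]]; [by right; exists K | left ..] => /=.
  - under eq_bigr do rewrite -mulN1r.
    rewrite single mulN1r sub0r opprK.
    by apply: le_trans (lower_ge0 v) _; case/andP: (lex v).
  - have := lex v; have := l_neq_pinfty v; rewrite /lower.
    case: (l v) lv => [a||] // _ _ /andP[lex_v _].
    under eq_bigr do rewrite -mulN1r.
    rewrite single mulN1r opprK addrC subr_ge0.
    by apply: le_trans lex_v; rewrite le_max lexx.
  - have := lex v; have := u_neq_ninfty v; rewrite /upper.
    case: (u v) uv => [a||] // _ _ /andP[_ lex_v].
    under eq_bigr do rewrite -[_%:R]mul1r.
    rewrite single mul1r subr_ge0.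
    by apply: le_trans lex_v _; rewrite ge_min lexx.
have weak : \sum_K y (clique_row K) * (1 - \sum_v (v \in val K)%:R * x v)
    <= \sum_i y i * (rhs i - \sum_v lhs i v * x v).
  rewrite /= big_sumType /= big_sumType /= -addrA lerDl addr_ge0 //.
    apply: sumr_ge0 => v _; apply: mulr_ge0 => //.
    by case: (rowP (inl (inr v))) => // -[].
  apply: sumr_ge0 => v _; apply: mulr_ge0 => //.
  by case: (rowP (inr v)) => // -[].
have exch (I : finType) (z : I -> rat) (a : I -> V -> rat) (b : I -> rat) :
    \sum_i z i * (b i - \sum_v a i v * x v)
    = \sum_i z i * b i - \sum_v x v * \sum_i z i * a i v.
  under eq_bigr do rewrite mulrBr mulr_sumr.
  rewrite sumrB exchange_big; congr (_ - _); apply: eq_bigr => v _.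
  by rewrite mulr_sumr; apply: eq_bigr => i _; ring.
move: weak; rewrite !exch /frac_cost /=.
under [X in _ <= _ - X]eq_bigr do rewrite y_eq.
under [X in X - _ <= _]eq_bigr do rewrite mulr1.
under [X in _ -> _ + X <= _]eq_bigr do rewrite penE /d mulrBr.
by rewrite sumrB; lra.
Qed.

(** The demand left uncovered by [L] is balanced at each vertex by copies of the
    upper bound, and an excess by copies of the lower bound. *)
Lemma integral_dual (L : seq {set V}) :
    (forall K, K \in L -> clique e K) ->
  exists y : row S -> nat,
    (forall v, \sum_i (lhs i v) *+ y i = (w v)%:~R)
    /\ \sum_i (rhs i) *+ y i = cost lower upper w 1 L.
Proof.
move=> cliqL.
have [down downP] := exists_down_row; have [up upP] := exists_up_row.
have clique0 : clique e set0 by apply/forall_inP => x; rewrite inE.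
(* On [L], whose members are cliques, the default [set0] is never used. *)
pose rowK K := clique_row (insubd (exist _ set0 clique0) K).
pose z v := (w v * 1%:Z - (cover_degree L v)%:Z)%R.
pose s := [seq rowK K | K <- L]
  ++ flatten [seq nseq `|z v| (if (0 <= z v)%R then up v else down v) | v <- enum V].
have sumE (a : row S -> rat) : \sum_i a i *+ count_mem i s
    = \sum_(K <- L) a (rowK K)
      + \sum_v (if (0 <= z v)%R then a (up v) else a (down v)) * `|z v|%:R.
  rewrite -big_count_mem big_cat big_map big_flatten big_map big_enum /=.
  congr (_ + _); apply: eq_bigr => v _.
  by rewrite big_nseq iter_addr_0 mulr_natr; case: ifP.
have absE v : `|z v|%N%:R = (if (0 <= z v)%R then 1 else -1) * (z v)%:~R :> rat.
  rewrite natr_absz; case: (lerP 0 (z v)) => z0.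
    by rewrite ger0_norm // mul1r.
  by rewrite ltr0_norm // mulrNz mulN1r.
exists (fun i => count_mem i s); split=> [v|]; rewrite sumE.
  have -> : \sum_(K <- L) lhs (rowK K) v = (cover_degree L v)%:R.
    rewrite /cover_degree -sum1_count natr_sum [RHS]big_mkcond.
    apply: eq_big_seq => K KL; rewrite /= insubdK; last exact: cliqL.
    by case: (v \in K).
  rewrite (bigD1 v) // big1 => [|x xv]; last first.
    rewrite (upP x).1 (downP x).1 eq_sym (negbTE xv) oppr0.
    by case: ifP; rewrite mul0r.
  rewrite (upP v).1 (downP v).1 eqxx absE /= addr0 mulrA.
  have -> (b : bool) (p : rat) : (if b then p else - p) * (if b then 1 else -1)
    = p by case: b; rewrite ?mulr1 ?mulrN1 ?opprK.
  by rewrite mul1r /z mulr1 intrB addrC subrK.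
rewrite /cost; congr (_ + _).
  rewrite -sum1_size natr_sum; apply: eq_big_seq => K KL //.
apply: eq_bigr => v _; rewrite (upP v).2 (downP v).2 absE mulrA.
case: (lerP 0 (z v)) => z0.
  by rewrite mulr1 (penalty_ge0E lower_le_upper) ?ler0z.
by rewrite mulrN1 opprK (penalty_le0E lower_le_upper) ?lerz0 ?ltW.
Qed.

End BoxSystem.

(** * Box-perfectness *)

Theorem theorem3p7 (R : realFieldType) (V : finType) (e : rel V)
    (e_sym : symmetric e) (e_irr : irreflexive e) :
  ESP e -> box_perfect R e.
Proof.
move=> espG l u w fin.
have [L cliqL minL] := integral_cost_minimum w (lower_ge0 l)
  (lower_le_upper fin) (sum_lower fin) espG.
have [y [y_eq y_cost]] := integral_dual fin cliqL.
have yE (a : row (box_system (clique_system e) l u) -> rat) :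
    \sum_i (y i)%:Z%:~R * ratr (a i) = ratr (\sum_i a i *+ y i) :> R.
  rewrite rmorph_sum; apply: eq_bigr => i _.
  by rewrite rmorphMn /= -mulr_natl.
exists (fun i => (y i)%:Z); split.
  by split=> [i|v]; rewrite ?ler0z // yE y_eq ratr_int.
move=> z z_feas; rewrite /dual_value yE y_cost leNgt; apply/negP => z_lt.
have [q [q_ge0 q_eq q_lt]] := dual_transfer z_feas z_lt.
move: q_lt; rewrite ltNge (le_trans _ (frac_cost_le_dual fin q_ge0 q_eq)) //.
by apply: minL => K; apply: q_ge0.
Qed.
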